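(* Let $X=\{\sigma_1,\dots,\sigma_K\}$ be a finite simplicial complex such that $X_k=\{\sigma_1,\dots,\sigma_k\}$ is a subcomplex of $X$ for every $1\le k\le K$, let $X_0=\emptyset$, and let $\mathbb{X}: \emptyset=X_0\subset X_1\subset\cdots\subset X_K=X$ be the resulting filtration. Let $q\ge 0$ and let $D_q(\mathbb{X})=\{(b_j,d_j)\mid j=1,\dots,p\}$ be its $q$-th persistence diagram with coefficients in a field $\Bbbk$. Let $\{x_j\mid j=1,\dots,p\}$ be persistence cycles for $D_q(\mathbb{X})$, with $x_j$ corresponding to $(b_j,d_j)$. If $z_i$ is a persistent volume for $(b_i,d_i)\in D_q(\mathbb{X})$, then $\{x_j\mid j\ne i\}\cup\{\partial z_i\}$, with $\partial z_i$ corresponding to $(b_i,d_i)$, are also persistence cycles for $D_q(\mathbb{X})$.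
   Context: Coefficients are in a field $\Bbbk$. $C_q$, $Z_q$, $B_q$ denote simplicial $q$-chains, cycles and boundaries, $\partial$ is the boundary operator, and $H_q(X_k)=Z_q(X_k)/B_q(X_k)$. The persistent homology $H_q(\mathbb{X})$ is the family of vector spaces $H_q(X_k)$, $0\le k\le K$, with the maps induced by inclusions. It decomposes uniquely as $\bigoplus_{i=1}^p I(b_i,d_i)$ with $b_i<d_i\le\infty$, where the interval module $I(b,d)$ is $\Bbbk$ at indices $k$ with $b\le k<d$ and $0$ elsewhere, with identity maps between the nonzero spaces and zero maps otherwise. The $q$-th persistence diagram is the multiset $D_q(\mathbb{X})=\{(b_i,d_i)\mid i=1,\dots,p\}$. Persistence cycles for $D_q(\mathbb{X})$: a family $\{x_i\}_{i=1}^p\subset C_q(X)$ such that (a) for each $i$, $x_i\notin Z_q(X_{b_i-1})$ and $x_i\in Z_q(X_{b_i})$; (b) for each $i$, $x_i\notin B_q(X_k)$ for all $k<d_i$, and, if $d_i<\infty$, $x_i\in B_q(X_{d_i})$; (c) for each $k$, the classes $\{[x_i]_k\mid b_i\le k<d_i\}$ form a basis of $H_q(X_k)$, where $[x]_k$ denotes the class of $x$ in $H_q(X_k)$. Persistent volume: for a $q$-simplex $\sigma_k$, let $\sigma_k^*$ be the linear functional on $C_q(X)$ with $\sigma_k^*(\sigma_j)=\delta_{kj}$ for all $q$-simplices $\sigma_j$. For $(b_i,d_i)\in D_q(\mathbb{X})$ with $d_i<\infty$ and each $m$, put $\mathcal{F}_m=\{\sigma_k \ m\text{-simplex}\mid b_i<k<d_i\}$.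 A chain $z\in C_{q+1}(X)$ is a persistent volume for $(b_i,d_i)$ (defined only if $d_i<\infty$) if: (1) $z=\sigma_{d_i}+\sum_{\sigma_k\in\mathcal{F}_{q+1}}\alpha_k\sigma_k$ for some $\alpha_k\in\Bbbk$; (2) $\tau^*(\partial z)=0$ for all $\tau\in\mathcal{F}_q$; (3) $\sigma_{b_i}^*(\partial z)\ne 0$. *)

(* Defs.v *)
From HB Require Import structures.
From mathcomp Require Import all_boot all_order all_algebra.

Set Implicit Arguments.
Unset Strict Implicit.
Unset Printing Implicit Defensive.

Import Order.TTheory GRing.Theory.
Local Open Scope ring_scope.
Local Open Scope quotient_scope.

Section QuotientSpace.
Import VectorInternalTheory.
Variables (F : fieldType) (vT : vectType F) (U : {vspace vT}).

Definition quotv : Type := @Quotient.quot vT (pred_of_vspace U).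
HB.instance Definition _ := GRing.Zmodule.on quotv.

Definition qclass (v : vT) : quotv := \pi_(@Quotient.quot vT (pred_of_vspace U)) v.

Lemma qclass_eq v w : (qclass v = qclass w) <-> (v - w \in U).
Proof.
by rewrite /qclass (Quotient.idealrBE (pred_of_vspace U)); split=> /eqP.
Qed.

Lemma qclass_repr (h : quotv) : qclass (repr h) = h.
Proof. exact: reprK. Qed.

Lemma qclassB v w : qclass (v - w) = qclass v - qclass w.
Proof. exact: (raddfB \pi_(@Quotient.quot vT (pred_of_vspace U))). Qed.

Lemma qclassD v w : qclass (v + w) = qclass v + qclass w.
Proof. exact: (raddfD \pi_(@Quotient.quot vT (pred_of_vspace U))). Qed.

Definition qscale (a : F) (h : quotv) : quotv := qclass (a *: repr h).

Lemma qscaleE a v : qscale a (qclass v) = qclass (a *: v).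
Proof.
apply/qclass_eq; rewrite -scalerBr rpredZ //.
by apply/qclass_eq; rewrite qclass_repr.
Qed.

Lemma qscaleA a b h : qscale a (qscale b h) = qscale (a * b) h.
Proof. by rewrite -[h]qclass_repr !qscaleE scalerA. Qed.
Lemma qscale1 : left_id 1 qscale.
Proof. by move=> h; rewrite -[h]qclass_repr qscaleE scale1r. Qed.
Lemma qscaleDr : right_distributive qscale +%R.
Proof.
move=> a g h; rewrite -[h]qclass_repr -[g]qclass_repr.
by rewrite -qclassD !qscaleE scalerDr qclassD.
Qed.
Lemma qscaleDl h : {morph qscale^~ h : a b / a + b}.
Proof.
by move=> a b; rewrite -[h]qclass_repr !qscaleE scalerDl qclassD.
Qed.

HB.instance Definition _ := GRing.Zmodule_isLmodule.Build F quotv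
  qscaleA qscale1 qscaleDr qscaleDl.

Fact qclass_is_linear : linear qclass.
Proof. by move=> a v w; rewrite qclassD -qscaleE. Qed.
HB.instance Definition _ :=
  GRing.isLinear.Build F vT quotv _ qclass qclass_is_linear.

(* Finite dimensionality: quotv is isomorphic to the complement U^C. *)
Let cproj (v : vT) : subvs_of (U^C)%VS := vsproj (U^C)%VS (v - projv U v).

Fact quotv_vect_iso : Vector.axiom (\dim (U^C)%VS) quotv.
Proof.
have cproj_lin a v w : cproj (a *: v + w) = a *: cproj v + cproj w.
  by rewrite /cproj -linearP; congr vsproj; rewrite linearP scalerBr opprD addrACA.
have cprojU v w : v - w \in U -> cproj v = cproj w.
  move=> Uvw; rewrite -[v](subrK w) -[v - w]scale1r cproj_lin.
  by rewrite {1}/cproj projv_id // subrr linear0 scaler0 add0r.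
have cprojE v : cproj (repr (qclass v)) = cproj v.
  by apply: cprojU; apply/qclass_eq; rewrite qclass_repr.
exists (fun h : quotv => v2r (cproj (repr h))).
  move=> a g h.
  transitivity (v2r (a *: cproj (repr g) + cproj (repr h))); last by rewrite linearD linearZ.
  rewrite -cproj_lin -[cproj (_ + _)]cprojE.
  by rewrite qclass_is_linear !qclass_repr.
exists (fun r => qclass (vsval (r2v r : subvs_of (U^C)%VS))).
  move=> h; rewrite v2rK /cproj vsprojK ?memv_projC // -[RHS]qclass_repr.
  apply/qclass_eq; rewrite addrAC subrr sub0r rpredN; exact: memv_proj.
move=> r; rewrite cprojE -[RHS]r2vK.
set u := r2v r; suff -> : cproj (vsval u) = u by [].
apply: val_inj; rewrite /cproj /= vsprojK ?memv_projC //.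
have: vsval u \in lker (projv U) by rewrite lker_proj subvsP.
by rewrite memv_ker => /eqP->; rewrite subr0.
Qed.
HB.instance Definition _ := Lmodule_hasFinDim.Build F quotv quotv_vect_iso.

End QuotientSpace.

Section PersistenceModules.
Variables (F : fieldType) (K : nat).

Record pmodule := PModule {
  psp : 'I_K.+1 -> vectType F;
  pmap : forall k l : 'I_K.+1, (k <= l)%N -> 'Hom(psp k, psp l);
  pmap_id : forall (k : 'I_K.+1) (h : (k <= k)%N) x, pmap h x = x;
  pmap_comp : forall (k l m : 'I_K.+1) (kl : (k <= l)%N) (lm : (l <= m)%N)
    (km : (k <= m)%N) x, pmap lm (pmap kl x) = pmap km x
}.

Definition pmod_iso (M N : pmodule) : Prop :=
  exists phi : forall k, 'Hom(psp M k, psp N k),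
    (forall k, bijective (phi k)) /\
    (forall (k l : 'I_K.+1) (kl : (k <= l)%N) x,
       phi l (pmap M kl x) = pmap N kl (phi k x)).

(* An interval [b, d), where d = None stands for d = oo. *)
Definition bar : Type := (nat * option nat)%type.

Definition lt_death (k : nat) (I : bar) : bool :=
  if I.2 is Some d then (k < d)%N else true.

Definition alive (I : bar) (k : nat) : bool := (I.1 <= k)%N && lt_death k I.

(* The space of I(b, d) at k is F^1 or F^0; pid_mx 1 is the identity between
   two copies of F^1, and zero otherwise. *)
Definition interval_sp (I : bar) (k : 'I_K.+1) : vectType F :=
  'rV[F]_(alive I k).
Definition interval_map (I : bar) (k l : 'I_K.+1) (_ : (k <= l)%N) :
    'Hom(interval_sp I k, interval_sp I l) :=
  linfun (mulmxr (pid_mx 1 : 'M_(alive I k, alive I l))).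

Lemma interval_map_id I (k : 'I_K.+1) (h : (k <= k)%N) x :
  interval_map I h x = x.
Proof.
rewrite lfunE /=; move: x; rewrite /interval_sp; case: (alive I k) => x.
  by rewrite pid_mx_1 mulmx1.
by rewrite [x]thinmx0 mul0mx.
Qed.

Lemma interval_map_comp I (k l m : 'I_K.+1) (kl : (k <= l)%N) (lm : (l <= m)%N)
  (km : (k <= m)%N) x :
  interval_map I lm (interval_map I kl x) = interval_map I km x.
Proof.
rewrite !lfunE /= -mulmxA mul_pid_mx; congr (_ *m _).
have klm : alive I k -> alive I m -> alive I l.
  rewrite /alive /lt_death => /andP[bk _] /andP[_ md].
  rewrite (leq_trans bk kl) /=; case: I.2 md => // d; exact: leq_ltn_trans.
apply/matrixP=> i j; rewrite !mxE.
have ak : alive I k by case: (alive I k) i => // -[].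
have am : alive I m by case: (alive I m) j => // -[].
by rewrite (klm ak am).
Qed.

Definition interval_module (I : bar) : pmodule :=
  PModule (@interval_map_id I) (@interval_map_comp I).

Definition pzero_sp (k : 'I_K.+1) : vectType F := 'rV[F]_0.
Definition pzero_map (k l : 'I_K.+1) (_ : (k <= l)%N) :
  'Hom(pzero_sp k, pzero_sp l) := \1%VF.
Definition pzero : pmodule.
Proof. by exists pzero_sp pzero_map => *; rewrite !id_lfunE. Defined.

Section DirectSum.
Variables M N : pmodule.
Definition psum_sp (k : 'I_K.+1) : vectType F := (psp M k * psp N k)%type.
Definition psum_fun (k l : 'I_K.+1) (kl : (k <= l)%N) (u : psum_sp k) :
  psum_sp l := (pmap M kl u.1, pmap N kl u.2).
Fact psum_fun_is_linear (k l : 'I_K.+1) (kl : (k <= l)%N) : linear (psum_fun kl).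
Proof. by move=> a u v; rewrite /psum_fun !linearP. Qed.
HB.instance Definition _ (k l : 'I_K.+1) (kl : (k <= l)%N) :=
  GRing.isLinear.Build F (psum_sp k) (psum_sp l) _ (psum_fun kl)
    (psum_fun_is_linear kl).
Definition psum_map (k l : 'I_K.+1) (kl : (k <= l)%N) :
  'Hom(psum_sp k, psum_sp l) := linfun (psum_fun kl).
Lemma psum_mapE (k l : 'I_K.+1) (kl : (k <= l)%N) u :
  psum_map kl u = (pmap M kl u.1, pmap N kl u.2).
Proof. exact: lfunE. Qed.
Definition psum : pmodule.
Proof.
exists psum_sp psum_map => [k h|k l m kl lm km] [x y]; rewrite !psum_mapE.
  by rewrite /= !pmap_id.
by rewrite /= (pmap_comp kl lm km) (pmap_comp kl lm km).
Defined.
End DirectSum.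

Definition interval_sum (D : seq bar) : pmodule :=
  foldr (fun I M => psum (interval_module I) M) pzero D.

End PersistenceModules.

Section Chains.
Variables (F : fieldType) (disp : Order.disp_t) (V : finOrderType disp).

Definition is_complex (A : {set {set V}}) : Prop :=
  set0 \notin A /\
  forall s t : {set V}, s \in A -> t \subset s -> t != set0 -> t \in A.

Definition is_simplex (q : nat) (s : {set V}) : bool := #|s| == q.+1.

(* Chains of all degrees on the finite vertex set V; a simplex is oriented by
   the order of V. *)
Definition chain : vectType F := {ffun {set V} -> F^o}.

Definition schain (s : {set V}) : chain := [ffun t => (t == s)%:R].

Definition dual (s : {set V}) (c : chain) : F := c s.

(* Deleting v from v_0 < ... < v_q has sign (-1)^i where v = v_i; the empty
   face is discarded, since homology is unreduced. *)
Definition bd_simplex (s : {set V}) : chain :=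
  \sum_(v in s | s :\ v != set0)
    (-1) ^+ #|[set u in s | (u < v)%O]| *: schain (s :\ v).

Definition bd_fun (c : chain) : chain := \sum_s dual s c *: bd_simplex s.

Fact bd_fun_is_linear : linear bd_fun.
Proof.
move=> a c c'; rewrite /bd_fun scaler_sumr -big_split; apply: eq_bigr => s _.
by rewrite /dual !ffunE scalerDl scalerA.
Qed.
HB.instance Definition _ :=
  GRing.isLinear.Build F chain chain _ bd_fun bd_fun_is_linear.

Definition bd : 'End(chain) := linfun bd_fun.

Definition Cq (q : nat) (A : {set {set V}}) : {vspace chain} :=
  <<[seq schain s | s <- enum A & is_simplex q s]>>%VS.
Definition Zq q A : {vspace chain} := (Cq q A :&: lker bd)%VS.
Definition Bq q A : {vspace chain} := (bd @: Cq q.+1 A)%VS.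

(* The quotient is taken inside the space of cycles. *)
Definition Bq_in_Zq q A : {vspace subvs_of (Zq q A)} :=
  (linfun vsval @^-1: Bq q A)%VS.
Definition Hq q A : vectType F := quotv (Bq_in_Zq q A).

(* [hclass q A c] is only meaningful when c \in Zq q A. *)
Definition hclass q A (c : chain) : Hq q A :=
  qclass (Bq_in_Zq q A) (vsproj (Zq q A) c).

Definition hmap_fun q A A' (h : Hq q A) : Hq q A' :=
  hclass q A' (vsval (repr h)).
Definition hmap q A A' : 'Hom(Hq q A, Hq q A') := linfun (@hmap_fun q A A').

Lemma CqS q (A A' : {set {set V}}) : A \subset A' -> (Cq q A <= Cq q A')%VS.
Proof.
move=> AA'; apply: sub_span => c /mapP[s].
rewrite mem_filter mem_enum => /andP[qs sA] ->.
by apply: map_f; rewrite mem_filter qs mem_enum (subsetP AA').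
Qed.
Lemma ZqS q (A A' : {set {set V}}) : A \subset A' -> (Zq q A <= Zq q A')%VS.
Proof. by move=> AA'; rewrite /Zq capvS ?CqS. Qed.
Lemma BqS q (A A' : {set {set V}}) : A \subset A' -> (Bq q A <= Bq q A')%VS.
Proof. by move=> AA'; rewrite /Bq limgS ?CqS. Qed.

Lemma hclass_eq q A c c' : c \in Zq q A -> c' \in Zq q A ->
  hclass q A c = hclass q A c' <-> c - c' \in Bq q A.
Proof.
move=> Zc Zc'; apply: iff_trans (qclass_eq _ _ _) _.
by rewrite -memv_preim linearB /= !lfunE /= !vsprojK.
Qed.

Lemma hclass_repr q A (h : Hq q A) : hclass q A (vsval (repr h)) = h.
Proof. by rewrite /hclass vsvalK; apply: qclass_repr. Qed.

Lemma hmap_fun_class q (A A' : {set {set V}}) c : A \subset A' ->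
  c \in Zq q A -> hmap_fun A' (hclass q A c) = hclass q A' c.
Proof.
move=> AA' Zc; apply/hclass_eq; rewrite ?(subvP (ZqS q AA')) ?subvsP //.
apply: (subvP (BqS q AA')); apply/hclass_eq; rewrite ?subvsP //.
exact: hclass_repr.
Qed.

Lemma hmap_class q (A A' : {set {set V}}) c : A \subset A' ->
  c \in Zq q A -> hmap q A A' (hclass q A c) = hclass q A' c.
Proof.
move=> AA' Zc; rewrite -(hmap_fun_class AA' Zc).
have hmap_lin : linear (@hmap_fun q A A').
  move=> a g h; rewrite -[g]hclass_repr -[h]hclass_repr.
  move: (vsval _) (subvsP (repr g)) (vsval _) (subvsP (repr h)) => u Zu v Zv.
  have lin B : a *: hclass q B u + hclass q B v = hclass q B (a *: u + v).
    by rewrite /hclass !linearP.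
  by rewrite lin !hmap_fun_class ?lin // rpredD ?rpredZ.
pose f := HB.pack_for {linear Hq q A -> Hq q A'} (@hmap_fun q A A')
  (GRing.isLinear.Build _ _ _ _ (@hmap_fun q A A') hmap_lin).
exact: (lfunE f).
Qed.

End Chains.
Arguments schain F {disp V} s.
Arguments bd {F disp V}.

Section Filtration.
Variables (F : fieldType) (disp : Order.disp_t) (V : finOrderType disp).
Variables (K : nat) (s : K.-tuple {set V}).

(* sigma_1, ..., sigma_K; sigma_0 = set0 is a dummy value, not a simplex. *)
Definition sigma (k : nat) : {set V} := nth set0 (set0 :: s) k.

Definition Xk (k : nat) : {set {set V}} := [set:: take k s].

Definition simplexwise_filtration : Prop :=
  uniq s /\ forall k, (1 <= k <= K)%N -> is_complex (Xk k).

Lemma XkS k l : (k <= l)%N -> Xk k \subset Xk l.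
Proof.
move=> kl; apply/subsetP=> t; rewrite !inE -(subnKC kl) takeD mem_cat.
by move->.
Qed.

Definition persistent_homology (q : nat) : pmodule F K.
Proof.
exists (fun k : 'I_K.+1 => Hq F q (Xk k))
  (fun (k l : 'I_K.+1) _ => hmap F q (Xk k) (Xk l)).
  by move=> k _ h; rewrite -[h]hclass_repr hmap_class ?subvsP.
move=> k l m kl lm km h; rewrite -[h]hclass_repr.
rewrite !hmap_class ?XkS ?subvsP //.
by rewrite (subvP (ZqS F q (XkS kl))) ?subvsP.
Defined.

(* The bounds by K make the decomposition unique: a finite d > K would be
   indistinguishable from oo over the index range 0..K. *)
Definition valid_bar (I : bar) : Prop :=
  (I.1 <= K)%N /\ (if I.2 is Some d then (I.1 < d <= K)%N else true).

Definition persistence_diagram (q p : nat) (D : p.-tuple bar) : Prop :=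
  (forall i, valid_bar (tnth D i)) /\
  pmod_iso (persistent_homology q) (interval_sum F K D).

Definition persistence_cycles (q p : nat) (D : p.-tuple bar)
    (x : 'I_p -> chain F V) : Prop :=
  [/\ forall i, x i \in Cq F q (Xk K),
      forall i, x i \notin Zq F q (Xk (tnth D i).1.-1) /\
                x i \in Zq F q (Xk (tnth D i).1),
      forall i,
        (forall k, (k <= K)%N -> lt_death k (tnth D i) ->
           x i \notin Bq F q (Xk k)) /\
        (forall d, (tnth D i).2 = Some d -> x i \in Bq F q (Xk d))
    & forall k, (k <= K)%N ->
        basis_of fullv [seq hclass q (Xk k) (x i)
                       | i <- enum 'I_p & alive (tnth D i) k]].

Definition in_Fm (m b d k : nat) : bool :=
  (b < k < d)%N && is_simplex m (sigma k).

Definition persistent_volume (q : nat) (I : bar) (z : chain F V) : Prop :=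
  if I.2 is Some d then
    [/\ z \in Cq F q.+1 (Xk K),
        exists alpha : nat -> F,
          z = schain F (sigma d) +
              \sum_(k < K.+1 | in_Fm q.+1 I.1 d k)
                alpha k *: schain F (sigma k),
        forall k, in_Fm q I.1 d k -> dual (sigma k) (bd z) = 0
      & dual (sigma I.1) (bd z) != 0]
  else False.

End Filtration.

(* Main.v *)
Require Import Defs.
From mathcomp Require Import all_boot all_order all_algebra.

(** The filtration adds one simplex at a time, so passing from [X_(k-1)] to
    [X_k] is controlled by a single coefficient, that of [sigma_k]: a chain of
    [X_k] lies in [X_(k-1)] as soon as this coefficient vanishes ([Cq_pred]).
    Let [z] be a persistent volume for [(b, d)] and let [x_i] be the old cycle
    of that bar.

    Birth.  The chain [bd z] lives in [X_d]. Its coefficient at [sigma_d] is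
    zero because [sigma_d] has degree [q + 1], and those at [sigma_k] with
    [b < k < d] are zero by definition of a volume, so [bd z] descends to
    [X_b] ([bd_volume_Zq]), and no further, since its coefficient at [sigma_b]
    is not zero.

    Death.  Suppose that [bd z = bd w] with [w] in [X_(d-1)]. Then [z - w] is a
    cycle whose coefficient at [sigma_d] is 1. Subtracting a multiple of it
    from any [(q+1)]-chain of [X_d] clears the coefficient at [sigma_d] and
    keeps the boundary, so [X_d] and [X_(d-1)] have the same [q]-boundaries
    ([Bq_stationary]). This contradicts that [x_i] becomes a boundary exactly
    at [d].

    Bases.  Both [bd z] and [x_i] are cycles of [X_b] with a nonzero coefficient
    at [sigma_b]; for [a] the quotient of these, [bd z - a x_i] is a cycle of
    [X_(b-1)]. Its class there is a combination of the [x_j] alive at [b - 1],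
    among which [x_i] does not occur. Pushing this relation forward to any [k]
    with [b <= k < d] kills the [x_j] that died in between, and expresses the
    class of [bd z] as [a [x_i]] plus a combination of the other [x_j] alive at
    [k]. As [a] is nonzero, [bd z] can replace [x_i] in the basis
    ([basis_exchange]). *)

Set Implicit Arguments.
Unset Strict Implicit.
Unset Printing Implicit Defensive.

Import Order.TTheory GRing.Theory.
Local Open Scope ring_scope.

(** * Steinitz exchange *)

(** The new family spans because [f i] is recovered from [v] by dividing by
    [a]; it is then a basis because its size is the dimension. Indexing by [r]
    rather than removing a vector from a list keeps the position of the
    exchanged vector. *)
Lemma basis_exchange (F : fieldType) (vT : vectType F) (U : {vspace vT})
    (I : eqType) (r : seq I) (f : I -> vT) (i : I) (a : F) (v : vT) :
  i \in r -> a != 0 -> basis_of U (map f r) ->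
  v - a *: f i \in <<[seq f j | j <- r & j != i]>>%VS ->
  basis_of U [seq if j == i then v else f j | j <- r].
Proof.
move=> ri a0 bas comb; rewrite basisEdim !size_map.
have /size_basis : basis_of U (in_tuple (map f r)) by [].
rewrite size_map => ->; rewrite leqnn andbT.
set g := fun j => if j == i then v else f j.
have gr j : j \in r -> g j \in <<map g r>>%VS by move=> rj; apply/memv_span/map_f.
have fg j : j \in r -> j != i -> f j \in <<map g r>>%VS.
  by move=> rj ji; have := gr j rj; rewrite /g (negPf ji).
rewrite -(span_basis bas); apply/span_subvP => _ /mapP[j rj ->].
have [->|] := eqVneq j i; last exact: fg.
have vg : v \in <<map g r>>%VS by have := gr i ri; rewrite /g eqxx.
have /subvP sub : (<<[seq f j | j <- r & j != i]>> <= <<map g r>>)%VS.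
  by apply/span_subvP => _ /mapP[l + ->]; rewrite mem_filter => /andP[li rl]; apply: fg.
have -> : f i = a^-1 *: (v - (v - a *: f i)).
  by rewrite subKr scalerA mulVf // scale1r.
by rewrite rpredZ // rpredB // sub.
Qed.

(** * Supports of chains and the boundary operator *)

Section BoundaryOperator.
Variables (F : fieldType) (disp : Order.disp_t) (V : finOrderType disp).
Implicit Types (A : {set {set V}}) (c : chain F V) (t : {set V}).

Lemma chainE c : c = \sum_t dual t c *: schain F t.
Proof.
apply/ffunP => t; rewrite sum_ffunE (bigD1 t) //= big1 => [|u ut].
  by rewrite !ffunE eqxx addr0 [RHS]mulr1.
by rewrite !ffunE eq_sym (negPf ut) [LHS]mulr0.
Qed.

(** Turns membership in the span of simplices into a condition on single
    coefficients, the form in which volumes are specified. *)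
Lemma CqP q A c :
  reflect (forall t, dual t c != 0 -> t \in A /\ is_simplex q t) (c \in Cq F q A).
Proof.
apply: (iffP idP) => [cC t|supp].
  suff: ~~ ((t \in A) && is_simplex q t) -> dual t c == 0.
    by move=> tA ct; apply/andP; apply: contraNT ct.
  move=> tA; pose X := in_tuple [seq schain F u | u <- enum A & is_simplex q u].
  have /coord_span -> : c \in <<X>>%VS by [].
  rewrite /dual sum_ffunE big1 // => l _; rewrite ffunE.
  have /mapP[u + ->] := mem_nth 0 (ltn_ord l : (l < size X)%N).
  rewrite mem_filter mem_enum => /andP[qu Au]; rewrite ffunE.
  by case: eqP tA => [->|_ _]; rewrite ?Au ?qu // [LHS]mulr0.
rewrite [c]chainE rpred_sum // => t _.
have [->|/supp[At qt]] := eqVneq (dual t c) 0; first by rewrite scale0r mem0v.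
by rewrite rpredZ // memv_span //; apply: map_f; rewrite mem_filter qt mem_enum.
Qed.

Lemma bd_schain t : bd (schain F t) = bd_simplex F t.
Proof.
rewrite lfunE /= /bd_fun (bigD1 t) //= big1 => [|u ut].
  by rewrite /dual ffunE eqxx scale1r addr0.
by rewrite /dual ffunE (negPf ut) scale0r.
Qed.

Lemma bd_in_Cq q A c : is_complex A -> c \in Cq F q.+1 A -> bd c \in Cq F q A.
Proof.
move=> [_ faces] cC; rewrite lfunE /= rpred_sum // => t _.
have [->|/(CqP _ _ _ cC)[At /eqP qt]] := eqVneq (dual t c) 0.
  by rewrite scale0r mem0v.
rewrite rpredZ // rpred_sum // => v /andP[tv tv0]; rewrite rpredZ // memv_span //.
apply: map_f; rewrite mem_filter mem_enum (faces t) ?subD1set // andbT.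
by rewrite /is_simplex -eqSS -qt (cardsD1 v t) tv.
Qed.

(** Removing [v] and then [w] gives the same face as removing [w] and then [v].
    If [w < v], removing [w] first lowers by one the number of vertices below
    [v], while removing [v] first does not change the number below [w]; the two
    terms thus have opposite signs and cancel in pairs. *)
Lemma bd_bd_simplex t : bd (bd_simplex F t) = 0.
Proof.
pose n (t' : {set V}) v := #|[set u in t' | (u < v)%O]|.
pose P (v w : V) := [&& v \in t, w \in t & t :\ v :\ w != set0].
pose G v w : chain F V :=
  (-1) ^+ n t v *: ((-1) ^+ n (t :\ v) w *: schain F (t :\ v :\ w)).
have PC v w : P v w = P w v by rewrite /P andbCA setDDl setUC -setDDl.
have anti v w : P v w -> (w < v)%O -> G w v = - G v w.
  move=> /and3P[tv tw _] wv.
  have nw : n (t :\ v) w = n t w.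
    apply: eq_card => u; rewrite !inE.
    by case: (eqVneq u v) => //= ->; rewrite (lt_gtF wv) andbF.
  have nv : n t v = (n (t :\ w) v).+1.
    rewrite /n (cardsD1 w) inE tw wv; congr _.+1; apply: eq_card => u.
    by rewrite !inE andbA.
  rewrite /G nw nv setDDl setUC -setDDl !scalerA exprS !mulN1r mulNr scaleNr opprK.
  by rewrite mulrC.
(* If v and w can both be removed, then t :\ v is nonempty, so the double sum is
   governed by the symmetric condition P. *)
have -> : bd (bd_simplex F t) = \sum_v \sum_(w | P v w && (w != v)) G v w.
  rewrite linear_sum [LHS]big_mkcond; apply: eq_bigr => v _ /=.
  case: ifP => [/andP[tv tv0]|].
    rewrite linearZ /= bd_schain /bd_simplex scaler_sumr; apply: eq_bigl => w.
    rewrite /P !inE tv /=; have [->|] := eqVneq w v; last by rewrite /= andbT.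
    by rewrite !andbF.
  move=> tv; rewrite big_pred0 // => w; apply/negP => /andP[/and3P[tv' tw tvw] wv].
  move/negP: tv; apply; rewrite tv'; apply: contraNneq tvw => ->.
  by rewrite set0D.
(* Pairing w < v with w > v, rather than showing that the sum is its own
   opposite, is what makes the cancellation valid in characteristic 2. *)
under eq_bigr => v _ do rewrite (bigID (fun w => (w < v)%O)) /=.
rewrite big_split /= [X in _ + X](exchange_big_dep xpredT) //= -big_split big1 //= => v _.
rewrite [X in _ + X](eq_bigl (fun w => P v w && (w != v) && (w < v)%O)); last first.
  by move=> w; rewrite PC eq_sym -leNgt le_eqVlt; case: eqVneq => //=; rewrite ?andbF.
rewrite -big_split big1 // => w /andP[/andP[Pvw _] wv] /=.
by rewrite [G w v]anti // subrr.
Qed.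

Lemma bd_bd c : bd (bd c) = 0.
Proof.
rewrite [c]chainE !linear_sum big1 // => t _.
by rewrite !linearZ /= bd_schain bd_bd_simplex scaler0.
Qed.

Lemma hclassBZ q A (a : F) c c' :
  hclass q A (c - a *: c') = hclass q A c - a *: hclass q A c'.
Proof. by rewrite /hclass !linearB !linearZ. Qed.

Lemma hclass_Bq0 q A c : c \in Zq F q A -> c \in Bq F q A -> hclass q A c = 0.
Proof.
move=> Zc Bc; have -> : 0 = hclass q A (0 : chain F V) by rewrite /hclass !linear0.
by apply/hclass_eq; rewrite ?mem0v ?subr0.
Qed.

End BoundaryOperator.

(** * Adding one simplex at a time *)

Section OneSimplexAtATime.
Variables (F : fieldType) (disp : Order.disp_t) (V : finOrderType disp).
Variables (K : nat) (s : K.-tuple {set V}).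
Implicit Types (c : chain F V) (t : {set V}).

Lemma sigma_in_Xk j k : (0 < j <= k)%N -> (k <= K)%N -> sigma s j \in Xk s k.
Proof.
rewrite inE /sigma; case: j => // j /= jk kK; rewrite -(nth_take _ jk) mem_nth //.
by rewrite size_takel ?size_tuple.
Qed.

(** The index [k] is arbitrary: [X_0] is empty, and beyond [K] the filtration is
    constant. *)
Lemma Xk_pred t k : t \in Xk s k -> t != sigma s k -> t \in Xk s k.-1.
Proof.
case: k => [|k]; rewrite !inE ?take0 //.
have [kK|Kk] := ltnP k K; last by rewrite !take_oversize ?size_tuple // leqW.
rewrite (take_nth set0) ?size_tuple // mem_rcons inE.
by case/orP => // ->.
Qed.

Lemma sigma_notin_Xk_pred k :
  uniq s -> (0 < k <= K)%N -> sigma s k \notin Xk s k.-1.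
Proof.
case: k => // k us /= kK; rewrite inE.
have := take_uniq k.+1 us; rewrite (take_nth set0) ?size_tuple //.
by rewrite rcons_uniq => /andP[].
Qed.

Lemma Cq_pred q k c :
  c \in Cq F q (Xk s k) -> dual (sigma s k) c = 0 -> c \in Cq F q (Xk s k.-1).
Proof.
move=> /CqP supp ck; apply/CqP => t ct; have [Xt qt] := supp t ct.
by split=> //; apply: Xk_pred => //; apply: contraNneq ct => ->; apply/eqP.
Qed.

Lemma dual_Cq_pred q k c : uniq s -> (0 < k <= K)%N ->
  c \in Cq F q (Xk s k.-1) -> dual (sigma s k) c = 0.
Proof.
move=> us kK /CqP supp; apply: contraNeq (sigma_notin_Xk_pred us kK).
by case/supp.
Qed.

End OneSimplexAtATime.

(** * Boundaries of persistent volumes *)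

Section Volume.
Variables (F : fieldType) (disp : Order.disp_t) (V : finOrderType disp).
Variables (K : nat) (s : K.-tuple {set V}) (q b d : nat) (z : chain F V).
Hypothesis filt : simplexwise_filtration s.
Hypothesis bdK : (b < d <= K)%N.
Hypothesis vol : persistent_volume s q (b, Some d) z.

Let us : uniq s. Proof. by case: filt. Qed.
Let dK : (0 < d <= K)%N.
Proof. by case/andP: bdK => bd ->; rewrite (leq_trans _ bd). Qed.

Lemma volume_top : dual (sigma s d) z = 1.
Proof.
case: vol => _ [al ->] _ _; rewrite /dual !ffunE eqxx sum_ffunE big1 ?addr0 //.
move=> k /andP[/andP[/= bk kd] _]; rewrite !ffunE.
case: eqP => [sdk|_]; last exact: mulr0.
case/negP: (sigma_notin_Xk_pred us dK); rewrite sdk; apply: sigma_in_Xk.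
  by rewrite (leq_trans _ bk) //= -ltnS prednK //; case/andP: dK.
by case/andP: dK => _; apply/leq_trans/leq_pred.
Qed.

Lemma volume_chain : z \in Cq F q.+1 (Xk s d).
Proof.
case: vol => /CqP supp [al zE] _ _; apply/CqP => t zt; split; last by case: (supp t zt).
have [d0 dK'] := andP dK.
apply: contraNT zt => tX; rewrite zE /dual !ffunE sum_ffunE big1 => [|k].
  have /negPf -> : t != sigma s d.
    by apply: contraNneq tX => ->; rewrite sigma_in_Xk ?d0 /=.
  by rewrite addr0.
case/andP=> /andP[/= bk kd] _; rewrite !ffunE.
case: eqP tX => [->|_ _]; last exact: mulr0.
by rewrite sigma_in_Xk // (leq_trans _ bk) //= ltnW.
Qed.

(** The coefficients of [bd z] are cleared from the top: at [d] by degree, then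
    at [d - 1, ..., b + 1] by the vanishing condition of a volume, which covers
    the [q]-simplices; the other coefficients vanish by degree. *)
Lemma bd_volume_Zq : bd z \in Zq F q (Xk s b).
Proof.
rewrite /Zq memv_cap memv_ker bd_bd eqxx andbT.
have [d0 dK'] := andP dK.
have /CqP zC := volume_chain.
have bC : bd z \in Cq F q (Xk s d) by apply: bd_in_Cq volume_chain; case: filt => _; apply.
have [_ _ bz _] := vol.
have bP : bd z \in Cq F q (Xk s d.-1).
  apply: Cq_pred => //; apply/eqP; apply: contraTT isT => /(CqP _ _ _ bC)[_ /eqP qd].
  have [|_ /eqP] := zC (sigma s d); first by rewrite volume_top oner_eq0.
  by rewrite qd => /eqP; rewrite eqn_leq ltnn andbF.
have desc n : (b + n < d)%N -> bd z \in Cq F q (Xk s (b + n)) -> bd z \in Cq F q (Xk s b).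
  elim: n => [|n IHn]; first by rewrite addn0.
  rewrite addnS => bnd /[dup] bn /Cq_pred pr; apply: IHn; first exact: ltnW.
  apply: pr; have [//|] := eqVneq (dual (sigma s (b + n).+1) (bd z)) 0.
  move=> /[dup] nz /(CqP _ _ _ bn)[_ qs]; apply: bz.
  by rewrite /in_Fm qs bnd /= ltnS leq_addr.
have bd' : (b <= d.-1)%N by case/andP: bdK => + _; case: (d).
by apply: (desc (d.-1 - b)%N); rewrite subnKC // prednK.
Qed.

(** The index 0 stands for the empty set, which is not a simplex, so no chain has
    a nonzero coefficient there. *)
Lemma volume_birth_gt0 : (0 < b)%N.
Proof.
have: bd z \in Cq F q (Xk s b) by have := bd_volume_Zq; rewrite memv_cap => /andP[].
move=> /CqP supp; have [_ _ _ /supp[_]] := vol.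
by rewrite lt0n; apply: contraTneq => -> /=; rewrite /is_simplex cards0.
Qed.

Lemma bd_volume_notin_Zq : bd z \notin Zq F q (Xk s b.-1).
Proof.
have [_ _ _ nz] := vol; rewrite memv_cap negb_and; apply/orP; left.
apply: contraNN nz => /dual_Cq_pred -> //; rewrite volume_birth_gt0 /=.
by case/andP: bdK => /ltnW/leq_trans; apply.
Qed.

Lemma bd_volume_bounding : bd z \in Bq F q (Xk s d).
Proof. exact: memv_img volume_chain. Qed.

(** If [bd z] already bounds some [w] before [d], then [sigma_d] completes the
    cycle [z - w] instead of killing a class, so its arrival creates no new
    boundary. *)
Lemma Bq_stationary : bd z \in Bq F q (Xk s d.-1) ->
  (Bq F q (Xk s d) <= Bq F q (Xk s d.-1))%VS.
Proof.
move=> /memv_imgP[w wC zw]; apply/subvP => _ /memv_imgP[u uC ->].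
have -> : bd u = bd (u - dual (sigma s d) u *: (z - w)).
  by rewrite linearB linearZ /= [bd (z - w)]linearB /= zw subrr scaler0 subr0.
apply: memv_img; apply: Cq_pred.
  have wC' : w \in Cq F q.+1 (Xk s d) by apply: (subvP (CqS F q.+1 (XkS s (leq_pred d)))).
  by rewrite rpredB // rpredZ // rpredB // volume_chain.
have w0 := dual_Cq_pred us dK wC; have z1 := volume_top.
rewrite /dual in w0 z1 *; rewrite !ffunE w0 z1 subr0.
by rewrite [X in _ - X]mulr1 subrr.
Qed.

End Volume.

Theorem theorem5 (F : fieldType) (disp : Order.disp_t) (V : finOrderType disp)
    (K : nat) (s : K.-tuple {set V}) (q p : nat) (D : p.-tuple bar)
    (x : 'I_p -> chain F V) (i : 'I_p) (z : chain F V) :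
  simplexwise_filtration s ->
  persistence_diagram F s q D ->
  persistence_cycles s q D x ->
  persistent_volume s q (tnth D i) z ->
  persistence_cycles s q D (fun j => if j == i then bd z else x j).
Proof.
move=> filt [valid _] [xC xZ xB xH].
have := valid i; have [] := xB i; have [] := xZ i.
case Di: (tnth D i) => [b [d|]] //= xiZ' xiZ xiB' xiB [_ bdK] vol.
have us : uniq s by case: filt.
have bK : (b <= K)%N by case/andP: bdK => /ltnW/leq_trans; apply.
have bZ := bd_volume_Zq filt bdK vol.
have b0 := volume_birth_gt0 filt bdK vol; rewrite /= in bdK bZ b0.
split=> [j|j|j|k kK]; try (case: ifPn => [/eqP ->|_] //; rewrite Di /=).
- case: ifPn => // _; apply: (subvP (CqS F q (XkS s bK))).
  by move: bZ; rewrite memv_cap => /andP[].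
- by split=> //; apply: bd_volume_notin_Zq bdK vol.
(* Boundaries persist, so it suffices to refute that bd z bounds at d - 1. *)
- split=> [k kK kd|e [<-]]; last exact: bd_volume_bounding bdK vol.
  have kd' : (k <= d.-1)%N by rewrite /lt_death /= in kd; case: (d) kd.
  apply/negP => /(subvP (BqS F q (XkS s kd'))) zB.
  have dd : (d.-1 < d)%N by rewrite ltn_predL (leq_ltn_trans _ (andP bdK).1).
  have /negP[] := xiB' d.-1 (leq_trans (leq_pred _) (andP bdK).2) dd.
  by apply: (subvP (Bq_stationary filt bdK vol zB)); apply: xiB.
set r := [seq j <- enum 'I_p | alive (tnth D j) k].
have [iAk|/negbTE iNk] := boolP (alive (tnth D i) k); last first.
  rewrite (_ : [seq _ | _ <- r] = [seq hclass q (Xk s k) (x j) | j <- r]) ?xH //.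
  apply/eq_in_map => j; rewrite mem_filter => /andP[jA _].
  by case: eqP jA => // ->; rewrite iNk.
have ri : i \in r by rewrite mem_filter iAk mem_enum.
(* The scalar for which bd z - a *: x i vanishes at sigma_b. *)
pose a := dual (sigma s b) (bd z) / dual (sigma s b) (x i).
have xi0 : dual (sigma s b) (x i) != 0.
  apply: contraNneq xiZ' => xi0; move: xiZ; rewrite !memv_cap => /andP[xiC ->].
  by rewrite andbT Cq_pred.
have a0 : a != 0 by have [_ _ _ nz] := vol; rewrite mulf_neq0 ?invr_eq0.
have bk : (b <= k)%N by move: iAk; rewrite Di => /andP[].
have pk : (b.-1 <= k)%N by rewrite (leq_trans (leq_pred _)).
have pK : (b.-1 <= K)%N by rewrite (leq_trans pk).
have iNp : alive (tnth D i) b.-1 = false by rewrite Di /alive /= -ltnS prednK // ltnn.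
have yZ : bd z - a *: x i \in Zq F q (Xk s b.-1).
  have : bd z - a *: x i \in Zq F q (Xk s b) by rewrite rpredB // rpredZ.
  rewrite !memv_cap => /andP[yC ->]; rewrite andbT Cq_pred //.
  rewrite {yC} /dual !ffunE -!/(dual _ _).
  by rewrite [X in _ - X](divfK xi0) subrr.
rewrite (_ : [seq _ | _ <- r] = [seq if j == i then hclass q (Xk s k) (bd z)
                                else hclass q (Xk s k) (x j) | j <- r]); last first.
  by apply: eq_map => j; case: ifP.
apply: (basis_exchange ri a0 (xH k kK)).
(* The relation is established at b - 1 and transported to k. *)
rewrite -hclassBZ -(hmap_class (XkS s pk) yZ).
have /(memv_img (hmap F q (Xk s b.-1) (Xk s k))) :=
  memvf (hclass q (Xk s b.-1) (bd z - a *: x i)).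
rewrite -(span_basis (xH _ pK)) limg_span; apply/subvP.
apply/span_subvP => _ /mapP[_ /mapP[j + ->] ->].
rewrite mem_filter => /andP[jp _].
have ji : j != i by apply: contraTneq jp => ->; rewrite iNp.
have xjZ : x j \in Zq F q (Xk s b.-1).
  by case/andP: jp => jb _; apply: (subvP (ZqS F q (XkS s jb))); case: (xZ j).
rewrite hmap_class ?XkS //.
(* A class alive at b - 1 and at k is in the span; one that died in between has
   become a boundary. *)
have [jk|jNk] := boolP (alive (tnth D j) k).
  by apply: memv_span; apply: map_f; rewrite mem_filter ji mem_filter jk mem_enum.
rewrite hclass_Bq0 ?mem0v //; first by apply: (subvP (ZqS F q (XkS s pk))).
have jb : ((tnth D j).1 <= k)%N by case/andP: jp => /leq_trans + _; apply.
have [_] := xB j; move: jNk; rewrite /alive jb /lt_death.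
case: (tnth D j).2 => // e /=; rewrite -leqNgt => ek /(_ e erefl).
by apply: (subvP (BqS F q (XkS s ek))).
Qed.
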